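(* Let $\mathsf{f}=(f_1,\dots,f_n)^\top\in\mathbb{R}^n$ and let $\mathsf{p}=(p_1,\dots,p_n)^\top$ be a probability vector with $p_i>0$ for all $i$. Let $\phi$ be strictly convex and twice continuously differentiable with $\phi(1)=0$, $\phi'(1)=0$ and $\phi''(1)>0$. For $\varepsilon\ge0$ let $$V_\phi(\varepsilon)=\max\Big\{\sum_{i=1}^n q_if_i\ \Big|\ \mathsf{q}\in\mathbb{R}^n,\ \sum_{i=1}^np_i\,\phi\Big(\frac{q_i}{p_i}\Big)\le\varepsilon,\ \sum_{i=1}^nq_i=1,\ q_i\ge0\ (i=1,\dots,n)\Big\}.$$ Then $$\lim_{\varepsilon\downarrow0}\frac{V_\phi(\varepsilon)-V_\phi(0)}{\sqrt{\varepsilon}}=\sqrt{\frac{2\,\mathbb{V}_{\mathsf{p}}(\mathsf{f})}{\phi''(1)}}.$$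
   Context: $\mathbb{V}_{\mathsf{p}}(\mathsf{f})=\sum_{i}p_i(f_i-\mathbb{E}_{\mathsf{p}}(\mathsf{f}))^2$ with $\mathbb{E}_{\mathsf{p}}(\mathsf{f})=\sum_ip_if_i$. The function $\phi$ is real-valued with the stated smoothness on $(0,\infty)$, and $\phi(0)$ is understood as $\lim_{z\downarrow0}\phi(z)\in(-\infty,+\infty]$. The limit in the claim is the worst-case sensitivity $\mathcal{S}_{\mathsf{p}}(\mathsf{f})$ (with growth function $g(\varepsilon)=\sqrt{\varepsilon}$). *)

(* Defs.v *)
From mathcomp Require Import all_boot all_order all_algebra.
From mathcomp Require Import all_classical all_reals all_analysis.

Set Implicit Arguments.
Unset Strict Implicit.
Unset Printing Implicit Defensive.

Import Order.TTheory GRing.Theory Num.Theory.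
Import numFieldNormedType.Exports.

Local Open Scope classical_set_scope.
Local Open Scope ring_scope.

(* Throughout, phi is a function on ]0, +oo[ : every notion below is
   independent of the values that the total function [phi : R -> R] takes on
   ]-oo, 0]. *)

Definition strictly_convex_pos (R : realType) (phi : R -> R) : Prop :=
  forall x y t : R, 0 < x -> 0 < y -> x != y -> 0 < t -> t < 1 ->
    phi (t * x + (1 - t) * y) < t * phi x + (1 - t) * phi y.

Definition C2_pos (R : realType) (phi : R -> R) : Prop :=
  forall x : R, 0 < x ->
    [/\ derivable phi x 1, derivable phi^`()%classic x 1
      & {for x, continuous phi^`(2)%classic}].

(* The extension of phi to [0, +oo[, with phi(0) the (possibly infinite)
   limit at 0 from the right; that limit exists as phi is convex.  Only used
   at nonnegative arguments. *)
Definition phi_ext (R : realType) (phi : R -> R) (z : R) : \bar R :=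
  if z == 0 then lim ((phi x)%:E @[x --> 0^'+]) else (phi z)%:E.

Definition is_prob_vector (R : realType) (n : nat) (p : 'rV[R]_n) : Prop :=
  (forall i, 0 <= p 0 i) /\ \sum_(i < n) p 0 i = 1.

Definition expect (R : realType) (n : nat) (p f : 'rV[R]_n) : R :=
  \sum_(i < n) p 0 i * f 0 i.

Definition var (R : realType) (n : nat) (p f : 'rV[R]_n) : R :=
  \sum_(i < n) p 0 i * (f 0 i - expect p f) ^+ 2.

Definition phi_divergence (R : realType) (n : nat) (phi : R -> R)
    (p q : 'rV[R]_n) : \bar R :=
  (\sum_(i < n) (p 0 i)%R%:E * phi_ext phi (q 0 i / p 0 i)%R)%E.

Definition uncertainty_set (R : realType) (n : nat) (phi : R -> R)
    (p : 'rV[R]_n) (eps : R) : set 'rV[R]_n :=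
  [set q | (phi_divergence phi p q <= eps%:E)%E /\ is_prob_vector q].

Definition objective_values (R : realType) (n : nat) (phi : R -> R)
    (p f : 'rV[R]_n) (eps : R) : set R :=
  [set \sum_(i < n) q 0 i * f 0 i | q in uncertainty_set phi p eps].

Definition is_maximum (R : realType) (A : set R) (m : R) : Prop :=
  A m /\ ubound A m.

(* As [sup] is total, that this is a maximum has to be asserted separately
   with [is_maximum]. *)
Definition worst_case (R : realType) (n : nat) (phi : R -> R)
    (p f : 'rV[R]_n) (eps : R) : R :=
  sup (objective_values phi p f eps).

(* Main.v *)
Require Import Defs.
From mathcomp Require Import all_boot all_order all_algebra.
From mathcomp Require Import all_classical all_reals all_analysis.
From mathcomp Require Import ring lra.

Import Order.TTheory GRing.Theory Num.Theory.
Import numFieldNormedType.Exports.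

Local Open Scope classical_set_scope.
Local Open Scope ring_scope.

(* Let c := phi''(1) and u_i := q_i / p_i.  A small divergence forces every u_i
   close to 1, where phi(x) lies between (c/2 - e)(x - 1)^2 and
   (c/2 + e)(x - 1)^2.  Hence the feasible set is squeezed between two balls
   of the weighted l^2 norm, and over the ball
   { k \sum_i p_i (u_i - 1)^2 <= eps } the increase of the objective, which is
   \sum_i p_i (u_i - 1)(f_i - E_p f), is at most sqrt (eps * var / k) by
   Cauchy-Schwarz, with equality at u_i = 1 + t (f_i - E_p f) for a suitable t.
   Letting k tend to c/2 from both sides gives the limit.

   The possibly infinite value phi(0) is avoided by truncation: since phi is
   nonincreasing on ]0, 1], the divergence is at most eps iff
   \sum_i p_i phi(max(u_i, d)) <= eps for all d in ]0, 1].  These conditions are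
   continuous in q, so the feasible set is compact and the maximum attained. *)

(** * Cauchy-Schwarz and the second-order expansion *)

(** With A, B the two weighted square sums and C the mixed sum, the square sum of
    [B * x i - C * y i] equals B (A B - C^2), which is therefore nonnegative. If B = 0, every
    [p i * y i ^+ 2] vanishes, and so does C. *)
Lemma cauchy_schwarz_weighted (R : realFieldType) (n : nat) (p x y : 'I_n -> R) :
  (forall i, 0 <= p i) ->
  (\sum_(i < n) p i * (x i * y i)) ^+ 2 <=
  (\sum_(i < n) p i * x i ^+ 2) * (\sum_(i < n) p i * y i ^+ 2).
Proof.
move=> p0.
have expand b c : \sum_(i < n) p i * (b * x i - c * y i) ^+ 2 =
    b ^+ 2 * (\sum_(i < n) p i * x i ^+ 2)
    - 2 * b * c * (\sum_(i < n) p i * (x i * y i))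
    + c ^+ 2 * (\sum_(i < n) p i * y i ^+ 2).
  rewrite !mulr_sumr -sumrB -big_split /=.
  by apply: eq_bigr => i _; ring.
move: expand; set A := \sum_(i < n) p i * x i ^+ 2.
set B := \sum_(i < n) p i * y i ^+ 2; set C := \sum_(i < n) _ => expand.
have B0 : 0 <= B by apply: sumr_ge0 => i _; rewrite mulr_ge0 ?sqr_ge0.
have : 0 <= B * (A * B - C ^+ 2).
  have -> : B * (A * B - C ^+ 2) =
      \sum_(i < n) p i * (B * x i - C * y i) ^+ 2 by rewrite expand; ring.
  by apply: sumr_ge0 => i _; rewrite mulr_ge0 ?sqr_ge0.
have [B_gt0|B_le0] := ltP 0 B; first by rewrite pmulr_rge0// subr_ge0.
have /eqP : B = 0 by apply/le_anti/andP.
rewrite psumr_eq0; last by move=> i _; rewrite mulr_ge0 ?sqr_ge0.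
move=> /allP y0 _.
have -> : C = 0.
  apply: big1 => i _; have /= := y0 i (mem_index_enum i).
  by rewrite mulf_eq0 sqrf_eq0 => /orP[]/eqP ->; ring.
rewrite expr0n mulr_ge0//.
by apply: sumr_ge0 => i _; rewrite mulr_ge0 ?sqr_ge0.
Qed.

(** Differentiability of phi' at [a] gives |phi'(x) - c (x - a)| <= e |x - a| near [a]. The mean
    value theorem for phi - (c/2) (x - a)^2, which vanishes at [a], supplies a second factor |x -
    a|. *)
Lemma derivative_quadratic_bound (R : realType) (phi : R -> R) (a : R) :
  (\forall x \near a, derivable phi x 1) ->
  derivable phi^`()%classic a 1 -> phi a = 0 -> phi^`()%classic a = 0 ->
  forall e : R, 0 < e -> \forall x \near a,
    `|phi x - phi^`(2)%classic a / 2 * (x - a) ^+ 2| <= e * (x - a) ^+ 2.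
Proof.
move=> dphi ddphi phia dphia e e0.
set c := phi^`(2)%classic a.
have key : \forall x \near a, `|phi^`()%classic x - c * (x - a)| <= e * `|x - a|.
  have dc : h^-1 *: ((phi^`()%classic \o shift a) (h *: 1) - phi^`()%classic a)
       @[h --> 0^'] --> c.
    have -> : c = 'D_1 phi^`()%classic a by rewrite -derive1E.
    exact: ddphi.
  have : \forall h \near (0 : R)^', `|phi^`()%classic (h + a) - c * h| <= e * `|h|.
    move/cvgrPdist_le : dc => /(_ e e0).
    apply: filterS2 (nbhs_dnbhs_neq 0) => h h0.
    rewrite /= dphia subr0 [_%:A]mulr1.
    rewrite -(ler_pM2r (_ : 0 < `|h|)) ?normr_gt0//.
    rewrite -normrM mulrBl distrC; congr (`|_ - _| <= _).
    by rewrite /GRing.scale/= mulrAC mulVf// mul1r.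
  (* The limit only covers h != 0; at h = 0 both sides of the bound are 0. *)
  rewrite near_withinE near_simpl.
  move=> H; apply/nbhs0P.
  near=> h; have [->|h0] := eqVneq h 0.
    by rewrite addr0 subrr normr0 !mulr0 dphia subrr normr0.
  have -> : a + h - a = h by ring.
  by rewrite (addrC a h); move: h0; near: h; exact: H.
have [d /= d0 Hd] : exists2 d : R, 0 < d & forall y, ball a d y ->
    derivable phi y 1 /\ `|phi^`()%classic y - c * (y - a)| <= e * `|y - a|.
  have : \forall y \near a, derivable phi y 1 /\
    `|phi^`()%classic y - c * (y - a)| <= e * `|y - a| by exact: filterI.
  by move=> /nbhs_ballP [d /= d0 Hd]; exists d.
apply/nbhs_ballP; exists d => //= x xd.
pose psi y := phi y - c / 2 * (y - a) ^+ 2.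
have dpsi y : ball a d y -> is_derive y 1 psi (phi^`()%classic y - c * (y - a)).
  move=> /Hd[dy _].
  have dphiy : is_derive y 1 phi (phi^`()%classic y).
    by rewrite derive1E; exact: derivableP.
  apply: is_deriveB.
  have dX : is_derive y (1 : R) (fun z : R => z - a) (1 - 0) by exact: is_deriveB.
  have -> : c * (y - a) = (c / 2) *: ((2%:R * (y - a) ^+ 1) *: (1 - 0 : R)).
    by rewrite /GRing.scale/=; field.
  exact: (is_deriveZ (c / 2) (is_deriveX 2 dX)).
have psia : psi a = 0 by rewrite /psi phia subrr expr0n mulr0 subr0.
have bnd y : `|y - a| <= `|x - a| -> ball a d y.
  by rewrite /ball/= distrC => h; rewrite (le_lt_trans h)// distrC.
rewrite -/(psi x).
have [z zx ->] : exists2 z, `|z - a| <= `|x - a| &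
    psi x = (phi^`()%classic z - c * (z - a)) * (x - a).
  have cpsi y : ball a d y -> {for y, continuous psi}.
    move=> /dpsi [dpsiy _]; apply: differentiable_continuous.
    exact/derivable1_diffP.
  have wpsi u v : (forall y, y \in `[u, v] -> `|y - a| <= `|x - a|) ->
      {within `[u, v], continuous psi}.
    move=> h; apply: continuous_in_subspaceT => y /set_mem /= yuv.
    exact/cpsi/bnd/h.
  case: (leP a x) => ax.
  - have h y : y \in `[a, x] -> `|y - a| <= `|x - a|.
      by rewrite in_itv/= => /andP[ay yx]; rewrite !ger0_norm; lra.
    have [z zax e1] := MVT_segment ax (fun y yax =>
      dpsi y (bnd y (h y (subset_itv_oo_cc yax)))) (wpsi _ _ h).
    by exists z; [exact: h|rewrite -e1 psia subr0].
  - have h y : y \in `[x, a] -> `|y - a| <= `|x - a|.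
      by rewrite in_itv/= => /andP[ay yx]; rewrite !ler0_norm; lra.
    have [z zax e1] := MVT_segment (ltW ax) (fun y yax =>
      dpsi y (bnd y (h y (subset_itv_oo_cc yax)))) (wpsi _ _ h).
    exists z; first exact: h.
    by rewrite -[LHS]opprK -[- psi x]add0r -psia e1 -mulrN opprB.
have [_ /= Hz] := Hd z (bnd z zx).
rewrite normrM (le_trans (ler_wpM2r (normr_ge0 _) Hz))// -mulrA ler_wpM2l ?(ltW e0)//.
by rewrite -[leRHS]ger0_norm ?sqr_ge0// normrX expr2 ler_wpM2r.
Unshelve. all: by end_near. Qed.

(** * Consequences of strict convexity *)

Lemma strictly_convex_pos_chord (R : realType) (phi : R -> R) (x t : R) :
  strictly_convex_pos phi -> phi 1 = 0 -> 0 < x -> 0 <= t <= 1 ->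
  phi (1 + t * (x - 1)) <= t * phi x.
Proof.
move=> phi_convex phi1 x0 /andP[].
rewrite le_eqVlt => /predU1P[<-|t0]; first by rewrite !mul0r addr0 phi1.
rewrite le_eqVlt => /predU1P[->|t1]; first by rewrite !mul1r addrC subrK.
have [->|x1] := eqVneq x 1; first by rewrite subrr mulr0 addr0 phi1 mulr0.
have := phi_convex x 1 t x0 ltr01 x1 t0 t1.
by rewrite phi1 mulr0 addr0 => /ltW; congr (phi _ <= _); ring.
Qed.

(** Local nonnegativity spreads along chords: a point 1 + t (x - 1) close to 1 satisfies 0 <= phi(1
    + t (x - 1)) < t phi(x). *)
Lemma strictly_convex_pos_gt0 (R : realType) (phi : R -> R) :
  strictly_convex_pos phi -> phi 1 = 0 -> (\forall x \near (1 : R), 0 <= phi x) ->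
  forall x, 0 < x -> x != 1 -> 0 < phi x.
Proof.
move=> phi_convex phi1 /nbhs_ballP[d /= d0 phi_ge0] x x0 x1.
have xd : 0 < `|x - 1| by rewrite normr_gt0 subr_eq0.
(* The first bound gives t < 1, the second t |x - 1| <= d / 2 < d. *)
pose t := Num.min (1 / 2) (d / 2 / `|x - 1|).
have t0 : 0 < t by rewrite lt_min !divr_gt0.
have t1 : t < 1 by rewrite gt_min; apply/orP; left; lra.
have td : `|t * (x - 1)| < d.
  rewrite normrM gtr0_norm// -ltr_pdivlMr// gt_min; apply/orP; right.
  by rewrite ltr_pM2r ?invr_gt0//; lra.
have /phi_ge0 : ball (1 : R) d (1 + t * (x - 1)).
  by rewrite /ball/= opprD addNKr normrN.
have := phi_convex x 1 t x0 ltr01 x1 t0 t1.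
rewrite (_ : t * x + (1 - t) * 1 = 1 + t * (x - 1)); last by ring.
rewrite phi1 mulr0 addr0 => lt_phi ge0.
by rewrite -(pmulr_rgt0 _ t0) (le_lt_trans ge0).
Qed.

(** The point y lies between x and 1, so the chord bound gives phi(y) <= t phi(x) <= phi(x) with t =
    (1 - y) / (1 - x). *)
Lemma strictly_convex_pos_nonincreasing (R : realType) (phi : R -> R) :
  strictly_convex_pos phi -> phi 1 = 0 -> (forall x, 0 < x -> 0 <= phi x) ->
  forall x y, 0 < x -> x <= y -> y <= 1 -> phi y <= phi x.
Proof.
move=> phi_convex phi1 phi_ge0 x y x0 xy y1.
have [x1|x1] := leP 1 x; first by rewrite (_ : x = y)//; lra.
have x1' : 0 < 1 - x by lra.
have t01 : 0 <= (1 - y) / (1 - x) <= 1.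
  by rewrite divr_ge0 ?ler_pdivrMr ?mul1r//=; lra.
have := strictly_convex_pos_chord _ _ x _ phi_convex phi1 x0 t01.
rewrite (_ : 1 + _ = y); last by field; rewrite gt_eqF.
move/le_trans; apply; rewrite ler_piMl ?phi_ge0//.
by case/andP: t01.
Qed.

(** If |x - 1| >= d, then 1 + d or 1 - d lies between 1 and x, and the chord bound makes phi(x) at
    least the value there. *)
Lemma strictly_convex_pos_separation (R : realType) (phi : R -> R) :
  strictly_convex_pos phi -> phi 1 = 0 ->
  (forall x, 0 < x -> x != 1 -> 0 < phi x) ->
  forall d, 0 < d < 1 ->
  exists2 m, 0 < m & forall x, 0 < x -> phi x < m -> `|x - 1| < d.
Proof.
move=> phi_convex phi1 phi_gt0 d /andP[d0 d1].
exists (Num.min (phi (1 + d)) (phi (1 - d))).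
  by rewrite lt_min !phi_gt0//; lra.
move=> x x0; rewrite lt_min => /andP[lt_p lt_m]; rewrite ltNge; apply/negP => dx.
have xd : 0 < `|x - 1| by lra.
have t01 : 0 <= d / `|x - 1| <= 1.
  by rewrite divr_ge0 ?ler_pdivrMr ?mul1r//=; lra.
have phix0 : 0 <= phi x by rewrite ltW// phi_gt0// -subr_eq0 -normr_gt0.
have : phi (1 + d / `|x - 1| * (x - 1)) <= phi x.
  apply: le_trans (strictly_convex_pos_chord _ _ x _ phi_convex phi1 x0 t01) _.
  by case/andP: t01 => _ ?; exact: ler_piMl.
apply/negP; rewrite -ltNge; have [x1|x1] := leP 1 x.
  rewrite ger0_norm ?subr_ge0// in xd *.
  by rewrite (_ : 1 + _ = 1 + d)//; field; rewrite gt_eqF.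
have x1' : 0 < 1 - x by lra.
rewrite ler0_norm ?opprB; last by lra.
by rewrite (_ : 1 + _ = 1 - d)//; field; rewrite gt_eqF.
Qed.

(** * Truncation near 0 and compactness of the feasible set *)

Lemma truncation_le (R : realType) (phi : R -> R) :
  (forall x y, 0 < x -> x <= y -> y <= 1 -> phi y <= phi x) ->
  forall z d d', 0 < Num.max z d -> d <= d' -> d' <= 1 ->
    phi (Num.max z d') <= phi (Num.max z d).
Proof.
move=> phi_ni z d d' m0 dd' d'1.
have [d'z|zd'] := leP d' z; first by rewrite max_l// (le_trans dd').
by apply: phi_ni => //; rewrite ge_max (ltW zd').
Qed.

Lemma phi_ext_cvg (R : realType) (phi : R -> R) :
  (forall x y, 0 < x -> x <= y -> y <= 1 -> phi y <= phi x) ->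
  forall z, 0 <= z ->
    (phi (Num.max z d))%:E @[d --> 0^'+] --> phi_ext phi z.
Proof.
move=> phi_ni z; rewrite /phi_ext le_eqVlt => /predU1P[<-|z0].
  (* The supremum only witnesses that the monotone limit exists in the extended reals; [cvgP] then
     yields convergence to [lim] itself. *)
  rewrite eqxx; have /cvgP : (phi x)%:E @[x --> 0^'+] -->
      ereal_sup [set (phi x)%:E | x in `]0, 1]].
    apply: (nonincreasing_at_right_cvge (f := fun x => (phi x)%:E) (BRight 1)).
      by rewrite bnd_simp.
    move=> x y; rewrite !in_itv/= => /andP[x0 _] /andP[_ y1] xy.
    by rewrite lee_fin phi_ni.
  apply: cvg_trans; apply: near_eq_cvg; near=> d.
  by rewrite max_r.
rewrite gt_eqF//; apply: cvg_near_cst; near=> d.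
by rewrite max_l//; near: d; exact: nbhs_right_le.
Unshelve. all: by end_near. Qed.

Lemma truncation_le_phi_ext (R : realType) (phi : R -> R) :
  (forall x y, 0 < x -> x <= y -> y <= 1 -> phi y <= phi x) ->
  forall z d, 0 <= z -> 0 < d -> d <= 1 ->
    ((phi (Num.max z d))%:E <= phi_ext phi z)%E.
Proof.
move=> phi_ni z d z0 d0 d1.
apply: cvge_to_ge (phi_ext_cvg _ _ phi_ni z z0) _.
near=> e; have e0 : 0 < e by [].
have ed : e <= d by near: e; exact: nbhs_right_le.
by rewrite lee_fin truncation_le// lt_max e0 orbT.
Unshelve. all: by end_near. Qed.

(** Truncation lowers each term, which gives one direction. For the other, d tends to 0 in the
    truncated sums; the terms are nonnegative, so the limit passes through the sum even when some
    phi(0) is infinite. *)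
Lemma uncertainty_setP (R : realType) (n : nat) (phi : R -> R)
    (p : 'rV[R]_n) (eps : R) (q : 'rV[R]_n) :
  (forall x, 0 < x -> 0 <= phi x) ->
  (forall x y, 0 < x -> x <= y -> y <= 1 -> phi y <= phi x) ->
  (forall i, 0 < p 0 i) ->
  uncertainty_set phi p eps q <->
  is_prob_vector q /\ forall d, 0 < d -> d <= 1 ->
    \sum_(i < n) p 0 i * phi (Num.max (q 0 i / p 0 i) d) <= eps.
Proof.
move=> phi_ge0 phi_ni p0; split.
  move=> [div_le q_prob]; split=> // d d0 d1.
  rewrite -lee_fin (le_trans _ div_le)// -sumEFin lee_sum// => i _.
  rewrite EFinM lee_wpmul2l ?lee_fin ?(ltW (p0 i))//.
  by apply: truncation_le_phi_ext => //; rewrite divr_ge0 ?(ltW (p0 i))// q_prob.1.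
move=> [q_prob trunc_le]; split=> //.
have : (\sum_(i < n) (p 0 i)%:E * (phi (Num.max (q 0 i / p 0 i) d))%:E)%E
    @[d --> 0^'+] --> phi_divergence phi p q.
  apply: cvg_nnesum => i _.
    near=> d; have d0 : 0 < d by [].
    by rewrite -EFinM lee_fin mulr_ge0 ?(ltW (p0 i))// phi_ge0// lt_max d0 orbT.
  apply: cvgeZl => //; apply: phi_ext_cvg => //.
  by rewrite divr_ge0 ?(ltW (p0 i))// q_prob.1.
apply: cvge_le; near=> d.
have d0 : 0 < d by [].
have d1 : d <= 1 by near: d; exact: nbhs_right_le.
under eq_bigr do rewrite -EFinM.
by rewrite sumEFin lee_fin trunc_le.
Unshelve. all: by end_near. Qed.

Lemma truncation_continuous (R : realType) (T : topologicalType) (phi : R -> R)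
    (g : T -> R) (a b d : R) :
  (forall x, 0 < x -> {for x, continuous phi}) -> 0 < d -> continuous g ->
  continuous (fun r => a * phi (Num.max (g r / b) d)).
Proof.
move=> phi_cont d0 gc r.
have m0 : 0 < Num.max (g r / b) d by rewrite lt_max d0 orbT.
apply: cvgM; first exact: cvg_cst.
apply: (@continuous_comp _ _ _ (fun r => Num.max (g r / b) d) phi).
  apply: (@continuous_max _ _ (fun r => g r / b) (fun=> d)).
    by apply: cvgM; [exact: gc|exact: cvg_cst].
  exact: cst_continuous.
exact: phi_cont.
Qed.

(** Each truncated condition is closed, as phi is evaluated only at points >= d > 0, where it is
    continuous; nonnegative coordinates of sum 1 lie in the unit cube. *)
Lemma uncertainty_set_compact (R : realType) (n : nat) (phi : R -> R)
    (p : 'rV[R]_n) (eps : R) :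
  (forall x, 0 < x -> 0 <= phi x) ->
  (forall x y, 0 < x -> x <= y -> y <= 1 -> phi y <= phi x) ->
  (forall x, 0 < x -> {for x, continuous phi}) ->
  (forall i, 0 < p 0 i) ->
  compact (uncertainty_set phi p eps).
Proof.
move=> phi_ge0 phi_ni phi_cont p0.
pose trunc d (q : 'rV[R]_n) :=
  \sum_(i < n) p 0 i * phi (Num.max (q 0 i / p 0 i) d).
have -> : uncertainty_set phi p eps =
    (\bigcap_(i in [set: 'I_n]) [set q : 'rV[R]_n | 0 <= q 0 i]) `&`
    [set q : 'rV[R]_n | \sum_(i < n) q 0 i = 1] `&`
    \bigcap_(d in [set d : R | 0 < d /\ d <= 1]) [set q | trunc d q <= eps].
  apply/seteqP; split=> q.
    move=> /(uncertainty_setP _ _ _ _ _ _ phi_ge0 phi_ni p0)[[q0 q1] qle].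
    by do !split=> //; [move=> i _; exact: q0|move=> d [? ?]; exact: qle].
  move=> [[q0 q1] qle]; apply/uncertainty_setP => //; split.
    by split=> // i; exact: q0.
  by move=> d ? ?; exact: qle.
have add_cont : continuous (fun x : R * R => x.1 + x.2) by exact: add_continuous.
apply: (subclosed_compact
  (B := [set q : 'rV[R]_n | forall i, `[0, 1]%classic (q ord0 i)])).
- apply: closedI; first apply: closedI.
  + apply: closed_bigI => i _.
    apply: (preimage_closed (f := fun q : 'rV[R]_n => q 0 i) (D := [set x | 0 <= x])).
      by move=> q _; exact: coord_continuous.
    exact: closed_ge.
  + apply: (preimage_closed (f := fun q : 'rV[R]_n => \sum_(i < n) q 0 i)
      (D := [set x | x = 1])) => [q _|]; last exact: closed_eq.
    by apply: continuous_big => // i _; exact: coord_continuous.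
  + apply: closed_bigI => d [d0 _].
    apply: (preimage_closed (f := trunc d) (D := [set x | x <= eps])); last first.
      exact: closed_le.
    move=> q _; apply: continuous_big => // i _.
    exact: (truncation_continuous _ _ _ _ (p 0 i) (p 0 i) _ phi_cont d0
      (@coord_continuous R 1 n 0 i)).
- by apply: (@rV_compact R n (fun=> `[0, 1]%classic)) => _; exact: segment_compact.
- move=> q [[q0 q1] _] i /=; rewrite in_itv/=; apply/andP; split; first exact: q0.
  by rewrite -q1 (bigD1 i)//= lerDl sumr_ge0// => j _; exact: q0.
Qed.

(** * Upper and lower bounds for the objective *)

Lemma expect_centered (R : realType) (n : nat) (p f : 'rV[R]_n) :
  \sum_(i < n) p 0 i = 1 -> \sum_(i < n) p 0 i * (f 0 i - expect p f) = 0.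
Proof.
move=> p1; under eq_bigr do rewrite mulrBr.
by rewrite sumrB -mulr_suml p1 mul1r subrr.
Qed.

Lemma var_ge0 (R : realType) (n : nat) (p f : 'rV[R]_n) :
  (forall i, 0 <= p 0 i) -> 0 <= var p f.
Proof. by move=> p0; apply: sumr_ge0 => i _; rewrite mulr_ge0 ?sqr_ge0. Qed.

(** Upper half of the squeeze. Since the other terms are nonnegative, [eps < p 0 i * m] forces phi
    below m at each truncated ratio, hence all ratios into the range of the quadratic minorant. *)
Lemma objective_le (R : realType) (n : nat) (f p q : 'rV[R]_n) (phi : R -> R)
    (eps k d m : R) :
  is_prob_vector p -> (forall i, 0 < p 0 i) ->
  (forall x, 0 < x -> 0 <= phi x) ->
  (forall x y, 0 < x -> x <= y -> y <= 1 -> phi y <= phi x) ->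
  0 < k -> d <= 1 / 2 ->
  (forall x, `|x - 1| < d -> k * (x - 1) ^+ 2 <= phi x) ->
  (forall x, 0 < x -> phi x < m -> `|x - 1| < d) ->
  (forall i, eps < p 0 i * m) -> 0 <= eps ->
  uncertainty_set phi p eps q ->
  \sum_(i < n) q 0 i * f 0 i <= expect p f + Num.sqrt eps * Num.sqrt (var p f / k).
Proof.
move=> [_ p1] p0 phi_ge0 phi_ni k0 d12 phi_k phi_m eps_m eps0.
move=> /(uncertainty_setP _ _ _ _ _ _ phi_ge0 phi_ni p0)[[q0 q1] qle].
(* Truncating at 1/2 loses nothing: the truncated ratios are within d <= 1/2
   of 1, hence equal to the u i. *)
have half0 : 0 < 1 / 2 :> R by lra.
have half1 : 1 / 2 <= 1 :> R by lra.
have {}qle := qle _ half0 half1.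
pose u i := q 0 i / p 0 i.
have m0 i : 0 < Num.max (u i) (1 / 2) by rewrite lt_max half0 orbT.
have maxd i : `|Num.max (u i) (1 / 2) - 1| < d.
  apply: phi_m => //; rewrite -(ltr_pM2l (p0 i)); apply: le_lt_trans (eps_m i).
  apply: le_trans qle; rewrite (bigD1 i)//= lerDl sumr_ge0// => j _.
  by rewrite mulr_ge0 ?(ltW (p0 j))//; exact: phi_ge0 _ (m0 j).
have maxE i : Num.max (u i) (1 / 2) = u i.
  apply: max_l; rewrite leNgt; apply/negP => ui.
  have := maxd i; rewrite max_r ?(ltW ui)// ltr_norml => /andP[+ _]; lra.
have sum_sq : \sum_(i < n) p 0 i * (u i - 1) ^+ 2 <= eps / k.
  rewrite ler_pdivlMr// mulr_suml; apply: le_trans qle; apply: ler_sum => i _.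
  rewrite -/(u i) -mulrA ler_wpM2l ?(ltW (p0 i))// mulrC maxE.
  by apply: phi_k; rewrite -[u i]maxE.
rewrite -lerBlDl.
have -> : \sum_(i < n) q 0 i * f 0 i - expect p f =
    \sum_(i < n) p 0 i * ((u i - 1) * (f 0 i - expect p f)).
  (* Both vectors have total mass 1, so f may be centred for free. *)
  have u1 : \sum_(i < n) p 0 i * (u i - 1) * expect p f = 0.
    rewrite -mulr_suml.
    under eq_bigr do rewrite mulrBr mulr1 /u mulrC divfK ?gt_eqF//.
    by rewrite sumrB q1 p1 subrr mul0r.
  rewrite -[RHS]addr0 -[X in _ = _ + X]u1 -big_split/=.
  rewrite -sumrB; apply: eq_bigr => i _.
  by rewrite /u; field; rewrite gt_eqF.
rewrite -sqrtrM//.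
apply: le_trans (ler_norm _) _; rewrite -sqrtr_sqr ler_wsqrtr//.
apply: le_trans (cauchy_schwarz_weighted _ _ _ _ _ (fun i => ltW (p0 i))) _.
rewrite mulrA mulrAC; apply: ler_wpM2r sum_sq.
by apply: var_ge0 => i; exact: ltW.
Qed.

(** Lower half of the squeeze: the equality case of Cauchy-Schwarz is feasible, because the
    smallness condition keeps its ratios positive and in the range of the quadratic majorant. *)
Lemma objective_attained (R : realType) (n : nat) (f p : 'rV[R]_n)
    (phi : R -> R) (eps K d : R) :
  is_prob_vector p -> (forall i, 0 < p 0 i) ->
  (forall x, 0 < x -> 0 <= phi x) ->
  (forall x y, 0 < x -> x <= y -> y <= 1 -> phi y <= phi x) ->
  0 < K -> d <= 1 ->
  (forall x, `|x - 1| < d -> phi x <= K * (x - 1) ^+ 2) ->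
  0 <= eps ->
  (forall i, Num.sqrt eps * Num.sqrt (K * var p f)^-1 *
             `|f 0 i - expect p f| < d) ->
  objective_values phi p f eps
    (expect p f + Num.sqrt eps * Num.sqrt (var p f / K)).
Proof.
move=> [_ p1] p0 phi_ge0 phi_ni K0 d1 phi_K eps0 small.
have var0 : 0 <= var p f by apply: var_ge0 => i; exact: ltW.
have Kvar0 : 0 <= K * var p f by rewrite mulr_ge0// ltW.
(* The solution of K t^2 var = eps; if the variance is 0, the convention 0^-1 = 0 makes t = 0. *)
set t := Num.sqrt eps * Num.sqrt (K * var p f)^-1 in small.
have t0 : 0 <= t by rewrite mulr_ge0 ?sqrtr_ge0.
have t2 : K * t ^+ 2 * var p f <= eps.
  rewrite exprMn !sqr_sqrtr ?invr_ge0//.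
  have [->|v0] := eqVneq (var p f) 0; first by rewrite mulr0.
  by rewrite le_eqVlt; apply/orP; left; apply/eqP; field; rewrite v0 gt_eqF.
have tv : t * var p f = Num.sqrt eps * Num.sqrt (var p f / K).
  rewrite /t -mulrA; congr (_ * _).
  have [->|v0] := eqVneq (var p f) 0; first by rewrite mulr0 mul0r sqrtr0.
  rewrite -[X in _ * X]ger0_norm// -sqrtr_sqr -sqrtrM ?invr_ge0//.
  by congr Num.sqrt; field; rewrite v0 gt_eqF.
pose u i := 1 + t * (f 0 i - expect p f).
have ud i : `|u i - 1| < d.
  by rewrite /u addrC addKr normrM (ger0_norm t0).
have u0 i : 0 < u i.
  by have := lt_le_trans (ud i) d1; rewrite ltr_norml => /andP[+ _]; lra.
have cent := expect_centered _ _ _ f p1.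
exists (\row_i (p 0 i * u i)); last first.
  rewrite -tv /var mulr_sumr -big_split/=.
  have centE : \sum_(i < n) t * expect p f * (p 0 i * (f 0 i - expect p f)) = 0.
    by rewrite -mulr_sumr cent mulr0.
  rewrite -[RHS]addr0 -[X in _ = _ + X]centE -big_split/=.
  by apply: eq_bigr => i _; rewrite mxE /u; ring.
apply/uncertainty_setP => //; split.
  split=> [i|]; first by rewrite mxE mulr_ge0 ?ltW.
  under eq_bigr do rewrite mxE /u mulrDr mulr1 mulrCA.
  by rewrite big_split/= -mulr_sumr cent mulr0 addr0.
move=> e e0 e1; apply: le_trans t2.
rewrite /var mulr_sumr; apply: ler_sum => i _.
rewrite mxE mulrAC divff ?gt_eqF// mul1r.
have -> : K * t ^+ 2 * (p 0 i * (f 0 i - expect p f) ^+ 2) =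
    p 0 i * (K * (u i - 1) ^+ 2) by rewrite /u; ring.
rewrite ler_wpM2l ?(ltW (p0 i))//; apply: le_trans (phi_K _ (ud i)).
(* Since u i > 0, truncation at level 0 leaves it unchanged, and raising the level to e can only
   lower phi. *)
have := truncation_le _ _ phi_ni (u i) 0 e; rewrite (max_l (ltW (u0 i))).
by apply=> //; exact: ltW.
Qed.

(** * Attainment of the maximum and the limit *)

Lemma is_maximum_sup (R : realType) (A : set R) (m : R) :
  is_maximum A m -> sup A = m.
Proof.
move=> [Am ubm]; apply/eqP; rewrite eq_le ge_sup//=; last by exists m.
by apply: ub_le_sup => //; exists m.
Qed.

Lemma mulrr_continuous (R : realType) (T : topologicalType) (g : T -> R) (a : R) :
  continuous g -> continuous (fun x => g x * a).
Proof. by move=> gc x; apply: cvgM; [exact: gc|exact: cvg_cst]. Qed.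

Theorem proposition4p2 (R : realType) (n : nat) (f p : 'rV[R]_n)
    (phi : R -> R)
    (p_prob : is_prob_vector p)
    (p_pos : forall i : 'I_n, 0 < p 0 i)
    (phi_convex : strictly_convex_pos phi)
    (phi_C2 : C2_pos phi)
    (phi1 : phi 1 = 0)
    (dphi1 : phi^`()%classic 1 = 0)
    (ddphi1 : 0 < phi^`(2)%classic 1) :
  (forall eps : R, 0 <= eps ->
     is_maximum (objective_values phi p f eps) (worst_case phi p f eps)) /\
  (worst_case phi p f eps - worst_case phi p f 0) / Num.sqrt eps
    @[eps --> 0^'+] --> Num.sqrt (2 * var p f / phi^`(2)%classic 1).
Proof.
set c := phi^`(2)%classic 1 in ddphi1 *.
have local_bound e : 0 < e -> \forall x \near (1 : R),
    `|phi x - c / 2 * (x - 1) ^+ 2| <= e * (x - 1) ^+ 2.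
  apply: derivative_quadratic_bound => //; last by have [] := phi_C2 1 ltr01.
  near=> x; have x0 : 0 < x by near: x; exact: lt_nbhsr.
  by have [] := phi_C2 x x0.
have phi_near0 : \forall x \near (1 : R), 0 <= phi x.
  apply: filterS (local_bound (c / 2) _) => [x|]; last by rewrite divr_gt0.
  rewrite ler_norml => /andP[+ _]; lra.
have phi_gt0 := strictly_convex_pos_gt0 _ _ phi_convex phi1 phi_near0.
have phi_ge0 x : 0 < x -> 0 <= phi x.
  by move=> x0; have [->|x1] := eqVneq x 1; rewrite ?phi1// ltW// phi_gt0.
have phi_ni := strictly_convex_pos_nonincreasing _ _ phi_convex phi1 phi_ge0.
have phi_cont x : 0 < x -> {for x, continuous phi}.
  move=> /phi_C2[dphix _ _]; apply: differentiable_continuous.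
  exact/derivable1_diffP.
have local_ball e : 0 < e -> exists2 d, 0 < d <= 1 / 2 &
    forall x, `|x - 1| < d ->
      (c / 2 - e) * (x - 1) ^+ 2 <= phi x <= (c / 2 + e) * (x - 1) ^+ 2.
  move=> e0; have /nbhs_ballP [d /= d0 dP] := local_bound e e0.
  (* The cap 1/2 matches the truncation level used in [objective_le]. *)
  exists (Num.min d (1 / 2)); first by rewrite lt_min d0 ge_min lexx orbT andbT; lra.
  move=> x; rewrite lt_min => /andP[xd _].
  have /dP : ball (1 : R) d x by rewrite /ball/= distrC.
  rewrite ler_distl mulrBl mulrDl; lra.
have p_in eps : 0 <= eps -> uncertainty_set phi p eps p.
  move=> eps0; apply/uncertainty_setP => //; split=> // d d0 d1.
  rewrite big1// => i _; rewrite divff ?gt_eqF//.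
  by rewrite max_l// phi1 mulr0.
have maxi eps : 0 <= eps ->
    is_maximum (objective_values phi p f eps) (worst_case phi p f eps).
  move=> eps0.
  have [|||q /set_mem qU qmax] := @EVT_max_rV R n
    (fun q => \sum_(i < n) q 0 i * f 0 i) (uncertainty_set phi p eps).
  - by exists p; exact: p_in.
  - exact: uncertainty_set_compact.
  - apply: continuous_subspaceT; apply: continuous_big; first exact: add_continuous.
    move=> i _; exact: (mulrr_continuous _ _ _ _ (@coord_continuous R 1 n 0 i)).
  have qm : is_maximum (objective_values phi p f eps) (\sum_(i < n) q 0 i * f 0 i).
    by split; [exists q|move=> _ [r rU <-]; apply: qmax; exact: mem_set].
  by rewrite /worst_case (is_maximum_sup _ _ _ qm).
split=> //.
have upper k : 0 < k -> k < c / 2 -> exists2 b, 0 < b &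
    forall eps, 0 <= eps -> eps < b ->
    worst_case phi p f eps <= expect p f + Num.sqrt eps * Num.sqrt (var p f / k).
  move=> k0 kc; have e0 : 0 < c / 2 - k by rewrite subr_gt0.
  have [d /andP[d0 d12] dP] := local_ball _ e0.
  have d01 : 0 < d < 1 by lra.
  have [m m0 mP] := strictly_convex_pos_separation _ _ phi_convex phi1 phi_gt0 d d01.
  (* Below this threshold eps is smaller than every [p 0 i * m]. *)
  exists (\big[Num.min/1]_(i < n) (p 0 i * m)).
    by apply/bigmin_gtP; split=> // i _; rewrite mulr_gt0.
  move=> eps eps0 /bigmin_gtP[_ epsm].
  have [[q qU <-] _] := maxi eps eps0.
  apply: (objective_le _ _ _ _ _ phi eps k d m) => // [x xd|i]; last exact: epsm.
  by have := dP x xd; rewrite subKr => /andP[].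
have lower K : c / 2 < K -> \forall eps \near 0^'+,
    expect p f + Num.sqrt eps * Num.sqrt (var p f / K) <= worst_case phi p f eps.
  move=> cK; have e0 : 0 < K - c / 2 by rewrite subr_gt0.
  have K0 : 0 < K by lra.
  have [d /andP[d0 d12] dP] := local_ball _ e0.
  (* The displacement is of order sqrt(eps), and there are finitely many indices. *)
  have small : \forall eps \near 0^'+, forall i,
      Num.sqrt eps * Num.sqrt (K * var p f)^-1 * `|f 0 i - expect p f| < d.
    apply: filter_forall => i.
    have : Num.sqrt eps * Num.sqrt (K * var p f)^-1 * `|f 0 i - expect p f|
        @[eps --> (0 : R)^'+] -->
        Num.sqrt 0 * Num.sqrt (K * var p f)^-1 * `|f 0 i - expect p f|.
      apply: cvg_at_right_filter; apply: cvgM; last exact: cvg_cst.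
      by apply: cvgM; [exact: sqrt_continuous|exact: cvg_cst].
    by rewrite sqrtr0 !mul0r => /cvgr_lt; exact.
  near=> eps; have eps0 : 0 <= eps by [].
  have [_] := maxi eps eps0; apply.
  apply: (objective_attained _ _ _ _ _ _ _ d) => // [|x xd|]; first lra.
    have := dP x xd; have -> : c / 2 + (K - c / 2) = K by ring.
    by case/andP.
  by near: eps.
have V0 : worst_case phi p f 0 = expect p f.
  apply/le_anti/andP; split.
    (* Any k in ]0, c/2[ would do: its coefficient sqrt(eps) is 0 here. *)
    have [||b b0 /(_ 0 (lexx _) b0)] := upper (c / 4); [lra|lra|].
    by rewrite sqrtr0 mul0r addr0.
  have [_] := maxi 0 (lexx _); apply; exists p => //; exact: p_in.
have c20 : 0 < c / 2 by lra.
rewrite (_ : 2 * var p f / c = var p f / (c / 2)); last by field; rewrite gt_eqF.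
have sens_cont : Num.sqrt (var p f / k) @[k --> c / 2] --> Num.sqrt (var p f / (c / 2)).
  apply: continuous_cvg; first exact: sqrt_continuous.
  by apply: cvgM; [exact: cvg_cst|apply: cvgV => //; rewrite gt_eqF].
apply/cvgrPdist_le => e e0.
(* Fix k and K on either side of c/2 first, each within e of the target value; only then let eps
   tend to 0, which traps the quotient between the two constants. *)
have [k k0 [kc kP]] : exists2 k, 0 < k & k < c / 2 /\
    `|Num.sqrt (var p f / (c / 2)) - Num.sqrt (var p f / k)| <= e.
  near ((c / 2)^'-) => k; exists k; first by near: k; exact: nbhs_left_gt.
  split=> //.
  by near: k; have /cvgrPdist_le := cvg_at_left_filter sens_cont; exact.
have [K cK KP] : exists2 K, c / 2 < K &
    `|Num.sqrt (var p f / (c / 2)) - Num.sqrt (var p f / K)| <= e.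
  near ((c / 2)^'+) => K; exists K => //.
  by near: K; have /cvgrPdist_le := cvg_at_right_filter sens_cont; exact.
have [b b0 bP] := upper k k0 kc.
near=> eps.
have eps0 : 0 < eps by [].
have epsb : eps < b by near: eps; exact: nbhs_right_lt.
have sqrt_eps0 : 0 < Num.sqrt eps by rewrite sqrtr_gt0.
have up := bP eps (ltW eps0) epsb.
have low : expect p f + Num.sqrt eps * Num.sqrt (var p f / K) <=
    worst_case phi p f eps by near: eps; exact: lower.
set g := _ / Num.sqrt eps.
have gk : g <= Num.sqrt (var p f / k).
  by rewrite /g ler_pdivrMr// V0 mulrC lerBlDl.
have gK : Num.sqrt (var p f / K) <= g.
  by rewrite /g ler_pdivlMr// V0 mulrC lerBrDl.
move: kP KP; rewrite !ler_norml; lra.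
Unshelve. all: by end_near. Qed.
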